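(* Let $f\ge2$ be an integer and $l$ an odd prime with $l\equiv1\pmod f$; write $l=ef+1$. Let $K$ be a field with $\operatorname{char}K\nmid f!$, $\operatorname{char}K\ne l$, and $\operatorname{Gal}(K(\zeta_l)/K)\simeq(\mathbb{Z}/l\mathbb{Z})^\times=\langle\gamma\rangle$ (so $\gamma$ is a generator of $(\mathbb{Z}/l\mathbb{Z})^\times$). Put $\beta=\gamma^e$. For $t\in\mathbb{Z}/l\mathbb{Z}$ set $$T_t({\bf x})=\sum_{\substack{(i_0,\dots,i_{f-1})\in(\mathbb{Z}/l\mathbb{Z})^f\\ i_0+\beta i_1+\cdots+\beta^{f-1}i_{f-1}\equiv t}}x_{i_0}x_{i_1}\cdots x_{i_{f-1}}$$ for ${\bf x}=(x_1,\dots,x_{l-1})$ with the convention $x_0=0$. Let $V\subset K^{l-1}$ be defined by $h_m({\bf x}):=T_{\gamma^m}({\bf x})-T_{\gamma^{m+1}}({\bf x})=0$ for $m=1,\dots,e-1$, and let $h({\bf x}):=T_0({\bf x})-T_{\gamma}({\bf x})$. Then $h$ is a regular $f$-ic form which is multiplicative on $V$, i.e. there exists a bilinear map $\varphi:K^{l-1}\times K^{l-1}\to K^{l-1}$ with $\varphi(V\times V)\subset V$ and $h({\bf x})h({\bf y})=h(\varphi({\bf x},{\bf y}))$ for all ${\bf x},{\bf y}\in V$. Moreover, for each $d\in(\mathbb{Z}/l\mathbb{Z})^\times$ such a map is given by $\varphi_d({\bf x},{\bf y})=(z_{1,d},\dots,z_{l-1,d})$, $$z_{k,d}=(-1)^{f-1}\Big(\sum_{i=1}^{l-1}x_{-d^{-1}i}y_{k-i}-\sum_{i=1}^{l-1}x_{-d^{-1}i}y_{-i}\Big)\quad(k=1,\dots,l-1),$$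 subscripts modulo $l$ with $x_0=y_0=0$.
   Context: An $f$-ic form on $K^n$ is a homogeneous polynomial of degree $f$; when $\operatorname{char}K\nmid f!$ it has an associated symmetric $f$-linear form $\theta$ with $h({\bf x})=\theta({\bf x},\dots,{\bf x})$, and $h$ is called regular if $\theta({\bf v}_1,{\bf v}_2,\dots,{\bf v}_f)=0$ for all ${\bf v}_2,\dots,{\bf v}_f\in K^n$ implies ${\bf v}_1=0$. Points of $V$ are its $K$-rational points. *)

(* Defs.v *)
From HB Require Import structures.
From mathcomp Require Import all_boot all_order all_fingroup all_algebra.
From mathcomp Require Import all_solvable all_field.
From mathcomp Require Import mpoly.

Set Implicit Arguments.
Unset Strict Implicit.
Unset Printing Implicit Defensive.

Import GRing.Theory.
Local Open Scope ring_scope.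

(* K^n is 'rV[K]_n; a polynomial h is evaluated at x : 'rV[K]_n by h.@[x 0]. *)

Definition replace (T : Type) (f : nat) (v : {ffun 'I_f -> T}) (i : 'I_f)
    (u : T) : {ffun 'I_f -> T} :=
  [ffun j => if j == i then u else v j].

Definition multilinear (K : fieldType) (n f : nat)
    (theta : {ffun 'I_f -> 'rV[K]_n} -> K) : Prop :=
  forall (v : {ffun 'I_f -> 'rV[K]_n}) (i : 'I_f),
    scalar (fun u => theta (replace v i u)).

Definition symmetric_map (K : fieldType) (n f : nat)
    (theta : {ffun 'I_f -> 'rV[K]_n} -> K) : Prop :=
  forall (s : 'S_f) (v : {ffun 'I_f -> 'rV[K]_n}),
    theta [ffun j => v (s j)] = theta v.

(* When f! is nonzero in K there is exactly one such theta for each f-ic h. *)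
Definition associated_form (K : fieldType) (n f : nat) (h : {mpoly K[n]})
    (theta : {ffun 'I_f -> 'rV[K]_n} -> K) : Prop :=
  [/\ multilinear theta, symmetric_map theta
    & forall x : 'rV[K]_n, h.@[x 0] = theta [ffun=> x]].

Definition nondegenerate (K : fieldType) (n f : nat)
    (theta : {ffun 'I_f -> 'rV[K]_n} -> K) : Prop :=
  forall v1 : 'rV[K]_n,
    (forall v : {ffun 'I_f -> 'rV[K]_n},
       (forall i : 'I_f, i = 0 :> nat -> v i = v1) -> theta v = 0) ->
    v1 = 0.

Definition regular_form (K : fieldType) (n f : nat) (h : {mpoly K[n]}) : Prop :=
  h \is f.-homog /\
  exists theta : {ffun 'I_f -> 'rV[K]_n} -> K,
    associated_form h theta /\ nondegenerate theta.

Definition multiplication_map (K : fieldType) (n : nat) (V : 'rV[K]_n -> Prop)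
    (h : {mpoly K[n]}) (phi : 'rV[K]_n -> 'rV[K]_n -> 'rV[K]_n) : Prop :=
  [/\ (forall y, linear (phi^~ y)) /\ (forall x, linear (phi x)),
      forall x y, V x -> V y -> V (phi x y)
    & forall x y, V x -> V y -> h.@[x 0] * h.@[y 0] = h.@[phi x y 0]].

Definition multiplicative_on (K : fieldType) (n : nat) (V : 'rV[K]_n -> Prop)
    (h : {mpoly K[n]}) : Prop :=
  exists phi, multiplication_map V h phi.

(* Subscripts modulo l: for a family a_1, ..., a_(l-1), stored with a_(k+1) at
   ordinal k, [zext a i] is a_i for i in Z/l, with a_0 = 0. *)
Definition zext (l : nat) (A : nmodType) (a : 'I_l.-1 -> A) (i : 'Z_l) : A :=
  if nat_of_ord i is k.+1 then oapp a 0 (insub k) else 0.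

Lemma zext0 (l : nat) (A : nmodType) (a : 'I_l.-1 -> A) : zext a 0 = 0.
Proof. by []. Qed.

Lemma zextS (l : nat) (A : nmodType) (a : 'I_l.-1 -> A) (k : 'I_l.-1) :
  zext a k.+1%:R = a k.
Proof.
case: l a k => [|[|l]] a k; [by case: k | by case: k |].
rewrite /zext Zp_nat /= modn_small; last by exact: (ltn_ord k).
by case: insubP => [u _ /val_inj -> //|]; rewrite ltn_ord.
Qed.

Definition Tpoly (K : fieldType) (l f : nat) (beta t : 'Z_l) :
    {mpoly K[l.-1]} :=
  \sum_(i : {ffun 'I_f -> 'Z_l} | \sum_(j < f) beta ^+ j * i j == t)
    \prod_(j < f) zext (fun k : 'I_l.-1 => 'X_k : {mpoly K[l.-1]}) (i j).

Definition hm (K : fieldType) (l f e : nat) (gamma : {unit 'Z_l}) (m : nat) :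
    {mpoly K[l.-1]} :=
  let g := val gamma in
  Tpoly K f (g ^+ e) (g ^+ m) - Tpoly K f (g ^+ e) (g ^+ m.+1).

Definition hform (K : fieldType) (l f e : nat) (gamma : {unit 'Z_l}) :
    {mpoly K[l.-1]} :=
  let g := val gamma in
  Tpoly K f (g ^+ e) 0 - Tpoly K f (g ^+ e) g.

Definition variety (K : fieldType) (l f e : nat) (gamma : {unit 'Z_l})
    (x : 'rV[K]_l.-1) : Prop :=
  forall m : nat, (1 <= m <= e - 1)%N -> (hm K f e gamma m).@[x 0] = 0.

Definition phi_map (K : fieldType) (l f : nat) (d : {unit 'Z_l})
    (x y : 'rV[K]_l.-1) : 'rV[K]_l.-1 :=
  let dx (i : 'Z_l) := zext (x 0) (- ((val d)^-1 * i)) in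
  \row_(k < l.-1) ((-1) ^+ (f - 1) *
    (\sum_(i : 'Z_l | i != 0) dx i * zext (y 0) (k.+1%:R - i)
     - \sum_(i : 'Z_l | i != 0) dx i * zext (y 0) (- i))).

(* Main.v *)
(** Write [sigma_c] for the automorphism [zeta |-> zeta^c] of [K(zeta)], attach to
    a point [x] the element [X = \sum_i x_i zeta^i], and let [M] be the fixed field
    of [sigma_beta]. Expanding the relative norm [N X = \prod_(j < f)
    sigma_(beta^j) X] gives [\sum_t T_t(x) zeta^t]. As the only linear relation
    between the powers of [zeta] is [\sum_t zeta^t = 0], [x] lies on [V] exactly
    when [N X] lies in [K], and then [N X = h(x)]. The map [phi_d] encodes
    [(-1)^(f-1) sigma_(-d)(X) Y], so that multiplicativity is that of the norm.

    On all of [K^(l-1)], [h] is the norm followed by a linear functional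
    [lambda : K(zeta) -> K] with [lambda 1 = 1]. Polarizing at [(X, W, 1, ..., 1)]
    yields a nonzero multiple of [lambda (Tr X Tr W - Tr (X W))], the traces being
    from [K(zeta)] to [M]. If this vanishes for all [W], then [Tr X = 0], since
    [W = 1 / Tr X] gives [f - 1 <> 0]; and then [X = 0], since [W = 1 / X]
    gives [- f <> 0]. *)
Require Import Defs.
From HB Require Import structures.
From mathcomp Require Import all_boot all_order all_fingroup all_algebra.
From mathcomp Require Import all_solvable all_field.
From mathcomp Require Import mpoly ring.

Set Implicit Arguments.
Unset Strict Implicit.
Unset Printing Implicit Defensive.

Import GRing.Theory.
Local Open Scope ring_scope.

(** * Sums over permutations, cyclic products, homogeneity *)

(** The fibres of [s |-> (s i0, s i1)] over pairs of distinct indices are cosets of the pointwise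
    stabilizer of [i0] and [i1], hence all of the same size. *)
Lemma sum_perm2 (V : nmodType) (f : nat) (i0 i1 : 'I_f) (F : 'I_f -> 'I_f -> V) :
  i0 != i1 ->
  \sum_(s : 'S_f) F (s i0) (s i1) =
  (\sum_a \sum_(b | b != a) F a b)
    *+ #|[set s : 'S_f | (s i0 == i0) && (s i1 == i1)]|.
Proof.
move=> ne01; rewrite pair_big_dep /= -sumrMnl.
rewrite (partition_big (fun s : 'S_f => (s i0, s i1)) (fun p => p.2 != p.1)) /=;
  last by move=> s _; rewrite (inj_eq perm_inj) eq_sym.
apply: eq_bigr => -[a b] /= ne_ba.
(* [q] takes [i0] to [a] and [i1] to [b]; right translation by [q] maps the stabilizer onto the
   fibre. *)
pose t := tperm i0 a; pose q : 'S_f := (t * tperm (t i1) b)%g.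
have q0 : q i0 = a.
  rewrite permM tpermL tpermD //.
  by rewrite -(inj_eq (@perm_inj _ t)) /t tpermK tpermR eq_sym.
have q1 : q i1 = b by rewrite permM tpermL.
move: q q0 q1 => {t}q q0 q1; rewrite (reindex_inj (mulIg q)) /= -sumr_const.
apply: eq_big => [s | s /eqP[<- <-] //].
by rewrite inE xpair_eqE !permM -q0 -q1 !(inj_eq perm_inj).
Qed.

(** Ensures that the multiplicity in [sum_perm2] is nonzero in every field where [f!] is. *)
Lemma card_perm2_dvd (f : nat) (i0 i1 : 'I_f) : i0 != i1 ->
  (#|[set s : 'S_f | (s i0 == i0) && (s i1 == i1)]| %| f`!)%N.
Proof.
move=> /(sum_perm2 (fun _ _ => 1%N)) sum1.
have -> : f`! = (\sum_(s : 'S_f) 1)%N by rewrite sum1_card -card_Sn; apply: eq_card.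
rewrite [X in (_ %| X)%N]sum1.
by rewrite -mulr_natr natn dvdn_mull.
Qed.

Lemma big_cyclic_shift (R : Type) (idx : R) (op : Monoid.com_law idx)
    (A : pzSemiRingType) (b : A) (f : nat) (F : A -> R) :
  b ^+ f = 1 ->
  \big[op/idx]_(j < f) F (b * b ^+ j) = \big[op/idx]_(j < f) F (b ^+ j).
Proof.
case: f => [|f] bf1; first by rewrite !big_ord0.
rewrite big_ord_recr big_ord_recl /= -exprS bf1 expr0 Monoid.mulmC.
by congr (op _ _); apply: eq_bigr => j _; rewrite -exprS.
Qed.

Lemma dhomog_prod1 (n f : nat) (A : nzRingType) (p : 'I_f -> {mpoly A[n]}) :
  (forall j, p j \is 1.-homog) -> \prod_(j < f) p j \is f.-homog.
Proof.
elim: f p => [|f IH] p p1; first by rewrite big_ord0 dhomog1.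
by rewrite big_ord_recr /= -[X in X.-homog]addn1 dhomogM ?IH.
Qed.

(** * The group algebra of Z/l evaluated at powers of [zeta] *)

Section CyclotomicEvaluation.

Variables (n : nat) (K : fieldType) (L : splittingFieldType K) (zeta : L).
Local Notation l := n.+2.
Hypothesis zeta_prim : l.-primitive_root zeta.

Definition zpow (a : 'Z_l) : L := zeta ^+ a.

Lemma zpow0 : zpow 0 = 1. Proof. by []. Qed.

Lemma zpowD (a b : 'Z_l) : zpow (a + b) = zpow a * zpow b.
Proof. by rewrite /zpow -exprD -(prim_expr_mod zeta_prim (a + b)). Qed.

(* [sigma_c] applied to [\sum_i x i *: zeta ^+ i], for [c] a unit. *)
Definition cyc (c : 'Z_l) (x : 'Z_l -> K) : L := \sum_i x i *: zpow (c * i).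

Lemma eq_cyc c (x y : 'Z_l -> K) : x =1 y -> cyc c x = cyc c y.
Proof. by move=> xy; apply: eq_bigr => i _; rewrite xy. Qed.

Lemma cycB c (x y : 'Z_l -> K) : cyc c (fun i => x i - y i) = cyc c x - cyc c y.
Proof. by rewrite -sumrB; apply: eq_bigr => i _; rewrite scalerBl. Qed.

Lemma cycZ c a (x : 'Z_l -> K) : cyc c (fun i => a * x i) = a *: cyc c x.
Proof. by rewrite scaler_sumr; apply: eq_bigr => i _; rewrite scalerA. Qed.

Lemma cyc_sum c (I : finType) (x : I -> 'Z_l -> K) :
  cyc c (fun i => \sum_k x k i) = \sum_k cyc c (x k).
Proof. by rewrite exchange_big; apply: eq_bigr => i _; rewrite scaler_suml. Qed.

Lemma cyc_delta c a : cyc c (fun i => a * (i == 0)%:R) = a%:A.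
Proof.
rewrite /cyc (bigD1 0) // eqxx mulr1 [c * 0]mulr0 zpow0 big1; first by rewrite Monoid.mulm1.
by move=> i /negPf ->; rewrite mulr0 scale0r.
Qed.

Lemma cyc_const c a : c \is a GRing.unit -> cyc c (fun=> a) = 0.
Proof.
move=> Uc; rewrite /cyc -scaler_sumr.
have -> : \sum_i zpow (c * i) = \sum_(i < l) zeta ^+ i.
  by rewrite [RHS](reindex_inj (mulrI Uc)).
have := subrX1 zeta l; rewrite (prim_expr_order zeta_prim) subrr => /esym/eqP.
rewrite mulf_eq0 subr_eq0 => /orP[/eqP z1|/eqP->]; last by rewrite scaler0.
by have := prim_order_dvd zeta_prim 1; rewrite expr1 z1 eqxx.
Qed.

Lemma cyc_dilate c d (x : 'Z_l -> K) : d \is a GRing.unit ->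
  cyc c (fun i => x (d^-1 * i)) = cyc (c * d) x.
Proof.
move=> Ud; rewrite /cyc (reindex_inj (mulrI Ud)) /=.
by apply: eq_bigr => i _; rewrite mulKr // mulrA.
Qed.

(** Multiplication in the group algebra of Z/l, which every [cyc c] maps to the product of [L]. *)
Definition conv (x y : 'Z_l -> K) (t : 'Z_l) : K := \sum_i x i * y (t - i).

Lemma cycM c (x y : 'Z_l -> K) : cyc c (conv x y) = cyc c x * cyc c y.
Proof.
rewrite /cyc mulr_suml.
under eq_bigr do rewrite scaler_suml.
rewrite exchange_big; apply: eq_bigr => i _ /=.
rewrite mulr_sumr (reindex_inj (addrI i)) /=; apply: eq_bigr => k _.
by rewrite mulrDr zpowD [i + k]addrC addrK -scalerAl -scalerAr scalerA.
Qed.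

(** For [v] constantly equal to the coordinates of [x] this is [T_t(x)]; distinct factors are
    allowed for the sake of polarization. *)
Definition norm_conv (f : nat) (b : 'Z_l) (v : 'I_f -> 'Z_l -> K) (t : 'Z_l) : K :=
  \sum_(i : {ffun 'I_f -> 'Z_l} | \sum_(j < f) b ^+ j * i j == t)
    \prod_(j < f) v j (i j).

Lemma cyc_norm_conv (f : nat) (b c : 'Z_l) (v : 'I_f -> 'Z_l -> K) :
  cyc c (norm_conv b v) = \prod_(j < f) cyc (c * b ^+ j) (v j).
Proof.
rewrite bigA_distr_bigA /= (partition_big
  (fun i : {ffun 'I_f -> 'Z_l} => \sum_(j < f) b ^+ j * i j) xpredT) //=.
apply: eq_bigr => t _; rewrite scaler_suml; apply: eq_bigr => i /eqP <-.
rewrite scaler_prod mulr_sumr (big_morph _ zpowD zpow0).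
by congr (_ *: _); apply: eq_bigr => j _; rewrite mulrA.
Qed.

(** * Linear relations between the powers of [zeta] *)

(* Expresses that [zeta] has degree [l - 1] over [K]. *)
Hypothesis deg_zeta : (n.+1 <= adjoin_degree 1%AS zeta)%N.

(** Subtracting the last coefficient from all of them keeps the value and removes [zeta ^+ (l - 1)].
    What remains is a polynomial of degree below that of [zeta], so it is zero. *)
Lemma cyc_eq0 (x : 'Z_l -> K) : cyc 1 x = 0 -> forall i, x i = x 0.
Proof.
move=> x0; pose c := x ord_max.
pose p : {poly L} := \poly_(k < n.+1) (x (inord k) - c)%:A.
have pz : p.[zeta] = 0.
  have <- : cyc 1 (fun i => x i - c) = 0.
    by rewrite (cycB 1 x) x0 cyc_const ?unitr1 // subrr.
  rewrite /cyc big_ord_recr /= subrr scale0r addr0 horner_poly.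
  apply: eq_bigr => k _; rewrite mulr_algl mul1r.
  have -> : inord k = widen_ord (leqnSn n.+1) k :> 'I_l.
    by apply: val_inj; rewrite /= inordK // ltnS ltnW.
  by [].
have : p = 0.
  have op0 : (0 : {poly L}) \is a polyOver 1%AS by rewrite rpred0.
  have op : p \is a polyOver 1%AS.
    by apply/polyOver_poly => k _; rewrite rpredZ ?rpred1.
  rewrite -(Fadjoin_poly_unique op _ pz) ?raddf0 //.
  exact: leq_trans (size_poly _ _) deg_zeta.
move=> p0; suff xc i : x i = c by move=> i; rewrite !xc.
have [ltin|] := ltnP i n.+1.
  have := congr1 (fun q : {poly L} => q`_i) p0.
  rewrite coef_poly ltin coef0 inord_val => /eqP.
  by rewrite scaler_eq0 oner_eq0 orbF subr_eq0 => /eqP.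
move=> lein; congr x; apply/val_inj/eqP.
by rewrite eqn_leq /= lein -ltnS ltn_ord.
Qed.

Lemma cyc_inj (x y : 'Z_l -> K) : cyc 1 x = cyc 1 y ->
  forall i, x i - y i = x 0 - y 0.
Proof.
by move=> xy; apply: (@cyc_eq0 (fun i => x i - y i)); rewrite cycB xy subrr.
Qed.

(** Makes [sigma_c] well defined: families with equal values differ by a constant, which [cyc c]
    kills. *)
Lemma cyc_transfer c (x y : 'Z_l -> K) : c \is a GRing.unit ->
  cyc 1 x = cyc 1 y -> cyc c x = cyc c y.
Proof.
move=> Uc /cyc_inj xy; apply/eqP; rewrite -subr_eq0 -cycB.
by rewrite (eq_cyc c xy) cyc_const.
Qed.

(** The inverse lies in [K(zeta)], so its polynomial expression in [zeta] provides [w] for [c = 1];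
    [cyc_transfer] carries the relation to the other [c]. *)
Lemma cyc_inv (x : 'Z_l -> K) : cyc 1 x != 0 ->
  exists w, forall c, c \is a GRing.unit -> cyc c x * cyc c w = 1.
Proof.
move=> nzx; set v := cyc 1 x in nzx.
have Ev : v^-1 \in <<1; zeta>>%VS.
  rewrite rpredV rpred_sum // => i _.
  by rewrite rpredZ // rpredX // memv_adjoin.
pose p := Fadjoin_poly 1%AS zeta v^-1.
(* The minimal polynomial of [zeta] divides [X^l - 1], so [l] coefficients suffice. *)
have sz_p : (size p <= l)%N.
  apply: leq_trans (size_Fadjoin_poly _ _ _) _.
  have op : ('X^l - 1 : {poly L}) \is a polyOver 1%AS.
    by rewrite rpredB ?rpred1 ?rpredX ?polyOverX.
  have rt : root ('X^l - 1) zeta.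
    by rewrite rootE !hornerE (prim_expr_order zeta_prim) subrr.
  have := dvdp_leq _ (minPoly_dvdp op rt).
  rewrite size_minPoly size_XnsubC // ltnS; apply.
  by rewrite -size_poly_gt0 size_XnsubC.
have /fin_all_exists[w wP] (i : 'Z_l) : exists k : K, p`_i = k%:A.
  by apply/vlineP; have /polyOverP := Fadjoin_polyOver 1%AS zeta v^-1; apply.
have w1 : cyc 1 w = v^-1.
  rewrite -(Fadjoin_poly_eq Ev) -/p (horner_coef_wide _ sz_p).
  by apply: eq_bigr => i _; rewrite wP mulr_algl mul1r.
exists w => c Uc; rewrite -cycM -[RHS]scale1r -(cyc_delta c).
by apply: cyc_transfer => //; rewrite cycM w1 cyc_delta scale1r divff.
Qed.


(** * Points as coefficient families *)

Lemma Zp_ind (P : 'Z_l -> Prop) :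
  P 0 -> (forall k : 'I_n.+1, P k.+1%:R) -> forall i, P i.
Proof.
move=> P0 PS i; rewrite -[i]natr_Zp.
case: i => -[|k] ltk //=; exact: (PS (Ordinal (ltk : (k < n.+1)%N))).
Qed.

(* The relation [\sum_i zeta ^+ i = 0] is used to make the coordinate at 0 vanish. *)
Definition row_of (w : 'Z_l -> K) : 'rV[K]_n.+1 := \row_k (w k.+1%:R - w 0).

Definition coord (x : 'rV[K]_n.+1) : 'Z_l -> K := @zext l K (x 0).

Lemma coord_row_of w i : coord (row_of w) i = w i - w 0.
Proof.
rewrite /coord; elim/Zp_ind: i; first by rewrite zext0 subrr.
by move=> k; rewrite (@zextS n.+2) mxE.
Qed.

Lemma cyc_row_of c w : c \is a GRing.unit -> cyc c (coord (row_of w)) = cyc c w.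
Proof.
by move=> Uc; rewrite (eq_cyc c (coord_row_of w)) cycB cyc_const // subr0.
Qed.

Lemma coordP a (x y : 'rV[K]_n.+1) i :
  coord (a *: x + y) i = a * coord x i + coord y i.
Proof.
rewrite /coord; elim/Zp_ind: i; first by rewrite !zext0 mulr0 addr0.
by move=> k; rewrite !(@zextS n.+2) !mxE.
Qed.

Lemma coord_inj x : (forall i, coord x i = 0) -> x = 0.
Proof.
move=> x0; apply/rowP => k.
by have := x0 k.+1%:R; rewrite /coord (@zextS n.+2) mxE.
Qed.

(* Invariant under adding a constant to [x], hence a functional of [cyc 1 x]. *)
Definition gap (g : 'Z_l) (x : 'Z_l -> K) : K := x 0 - x g.

Lemma gap_cyc g x a : g != 0 -> cyc 1 x = a%:A -> gap g x = a.
Proof.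
move=> nzg; rewrite -(cyc_delta 1) => /cyc_inj/(_ g).
rewrite eqxx (negPf nzg) mulr0 mulr1 subr0 /gap => ->.
by rewrite opprB addrC subrK.
Qed.

(** * Polarization of the norm and regularity *)

Section Polarization.

Variables (f : nat) (b g : 'Z_l).

(** The average of a multilinear form over all permutations of its arguments, hence symmetric with
    the same diagonal. *)
Definition polar (v : {ffun 'I_f -> 'rV[K]_n.+1}) : K :=
  (f`!%:R)^-1 * \sum_(s : 'S_f) gap g (norm_conv b (fun j => coord (v (s j)))).

(** Each monomial has exactly one factor from slot [i] of [v], at position [s^-1 i]. *)
Lemma norm_conv_replace v i (s : 'S_f) t a (x y : 'rV[K]_n.+1) :
  let N u := norm_conv b (fun j => coord (replace v i u (s j))) t in
  N (a *: x + y) = a * N x + N y.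
Proof.
rewrite /= mulr_sumr -big_split; apply: eq_bigr => k _ /=.
have F u : \prod_(j < f) coord (replace v i u (s j)) (k j) =
    coord u (k ((s^-1)%g i)) *
    \prod_(j < f | j != (s^-1)%g i) coord (v (s j)) (k j).
  rewrite (bigD1 ((s^-1)%g i)) //= ffunE permKV eqxx; congr (_ * _).
  apply: eq_bigr => j ne_j; rewrite ffunE ifN //.
  by apply: contraNneq ne_j => <-; rewrite permK.
by rewrite !F coordP mulrDl mulrA.
Qed.

Lemma polar_multilinear : multilinear polar.
Proof.
move=> v i a x y; rewrite /polar mulrCA -mulrDr [a * _]mulr_sumr -big_split.
congr (_ * _); apply: eq_bigr => s _.
by rewrite /gap !norm_conv_replace /=; ring.
Qed.

Lemma eq_norm_conv (v w : 'I_f -> 'Z_l -> K) t :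
  (forall j, v j = w j) -> norm_conv b v t = norm_conv b w t.
Proof.
by move=> vw; apply: eq_bigr => i _; apply: eq_bigr => j _; rewrite vw.
Qed.

Lemma polar_symmetric : symmetric_map polar.
Proof.
move=> s v; congr (_ * _); rewrite [RHS](reindex_inj (mulIg s)).
apply: eq_bigr => s' _; rewrite /gap.
by congr (_ - _); apply: eq_norm_conv => j; rewrite ffunE permM.
Qed.

Hypothesis fact_neq0 : f`!%:R != 0 :> K.

Lemma polar_diag x :
  polar [ffun=> x] = gap g (norm_conv b (fun _ : 'I_f => coord x)).
Proof.
rewrite /polar; set c := RHS.
rewrite (eq_bigr (fun=> c)) => [|s _]; last first.
  by rewrite /c /gap; congr (_ - _); apply: eq_norm_conv => j; rewrite ffunE.
have -> : \sum_(s : 'S_f) c = c *+ f`!.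
  by rewrite -card_Sn -sumr_const; apply: eq_bigl.
by rewrite -[c *+ _]mulr_natl mulKf.
Qed.

Hypotheses (f_gt1 : (1 < f)%N) (b_root : b ^+ f = 1) (nz_g : g != 0).

Let Ub j : b ^+ j \is a GRing.unit.
Proof.
rewrite unitrX //; apply/unitrP; exists (b ^+ f.-1).
by rewrite -exprS -exprSr prednK // ltnW.
Qed.

(** At [(x, w, 1, ..., 1)] the sum over permutations counts each ordered pair of positions for [x]
    and [w] equally often, a number of times dividing [f!]. If the double sum lies in [K], [gap]
    reads it off. *)
Lemma polar_test (x : 'rV[K]_n.+1) w y :
  (forall v : {ffun 'I_f -> 'rV[K]_n.+1},
    (forall i : 'I_f, i = 0 :> nat -> v i = x) -> polar v = 0) ->
  \sum_(i < f) \sum_(j < f | j != i)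
    cyc (b ^+ i) (coord x) * cyc (b ^+ j) w = y%:A ->
  y = 0.
Proof.
move=> x_rad xw_y.
pose i0 := Ordinal (ltnW f_gt1); pose i1 := Ordinal f_gt1.
pose v : {ffun 'I_f -> 'rV[K]_n.+1} := [ffun j => if j == i0 then x else
  if j == i1 then row_of w else row_of (fun i => 1 * (i == 0)%:R)].
have v0 : polar v = 0 by apply: x_rad => i i_0; rewrite ffunE -val_eqE /= i_0.
pose N := #|[set s : 'S_f | (s i0 == i0) && (s i1 == i1)]|.
pose S t := \sum_(s : 'S_f) norm_conv b (fun j => coord (v (s j))) t.
have gapS : gap g S = 0.
  move/eqP: v0; rewrite mulf_eq0 invr_eq0 (negPf fact_neq0) => /eqP <-.
  by rewrite /gap -sumrB.
have cycS : cyc 1 S = (N%:R * y)%:A.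
  rewrite cyc_sum; under eq_bigr do rewrite cyc_norm_conv.
  rewrite -scalerA -xw_y scaler_nat -(@sum_perm2 _ _ i0 i1) //.
  (* After inverting [s], [x] stands at position [s i0] and [w] at [s i1]. *)
  rewrite (reindex_inj invg_inj) /=; apply: eq_bigr => s _.
  rewrite (bigD1 (s i0)) //= (bigD1 (s i1)) ?(inj_eq perm_inj) //=.
  rewrite !ffunE !permK !mul1r /= !cyc_row_of // big1 ?mulr1 // => j.
  rewrite -!(can2_eq (permKV s) (permK s)) => /andP[/negPf ne0 /negPf ne1].
  by rewrite mul1r ffunE ne0 ne1 cyc_row_of // cyc_delta scale1r.
move/eqP: (gap_cyc nz_g cycS); rewrite gapS eq_sym mulf_eq0 => /orP[]; last first.
  by move/eqP.
have /dvdnP[k Ef] := @card_perm2_dvd f i0 i1 isT.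
by move=> N0; move: fact_neq0; rewrite Ef natrM (eqP N0) mulr0 eqxx.
Qed.

Lemma polar_nondegenerate : Defs.nondegenerate polar.
Proof.
move=> x rad; have test := polar_test rad.
(* Both [f] and [f - 1] are factors of [f!]. *)
have [nzf nzf1] : f%:R != 0 :> K /\ f%:R - 1 != 0 :> K.
  move: fact_neq0; case: f f_gt1 => [|[|m]] // _.
  rewrite [in m.+2%:R - 1]mulrSr addrK !factS !natrM !mulf_eq0 !negb_or.
  by case/and3P.
have sumE w : \sum_(i < f) \sum_(j < f | j != i)
      cyc (b ^+ i) (coord x) * cyc (b ^+ j) w =
    (\sum_(i < f) cyc (b ^+ i) (coord x)) * (\sum_(i < f) cyc (b ^+ i) w)
      - \sum_(i < f) cyc (b ^+ i) (coord x) * cyc (b ^+ i) w.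
  rewrite mulr_suml -sumrB; apply: eq_bigr => i _.
  by rewrite mulr_sumr [in RHS](bigD1 i) //=; ring.
(* [tr] represents the trace of [X] to the fixed field of [sigma_b]. *)
pose tr t := \sum_(j < f) coord x ((b ^+ j)^-1 * t).
have cyc_tr c : cyc c tr = \sum_(j < f) cyc (c * b ^+ j) (coord x).
  by rewrite cyc_sum; apply: eq_bigr => j _; rewrite cyc_dilate.
have cyc_tr_shift k : cyc (b ^+ k) tr = cyc 1 tr.
  elim: k => [|k IH] //; rewrite -IH !cyc_tr.
  rewrite -(@big_cyclic_shift _ _ _ _ _ _ (fun c => cyc (b ^+ k * c) (coord x)) b_root).
  by apply: eq_bigr => j _; rewrite exprSr mulrA.
have tr0 : cyc 1 tr = 0.
  (* Testing against [W = 1 / Tr X], itself fixed by [sigma_b], gives [f - 1]. *)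
  apply/eqP/contraT => nz_tr; have [w wP] := cyc_inv nz_tr.
  have wE k : cyc (b ^+ k) w = (cyc 1 tr)^-1.
    by apply: (mulfI nz_tr); rewrite divff // -[in LHS](cyc_tr_shift k) wP.
  case/eqP: nzf1; apply: (test w); rewrite sumE.
  under [X in _ * X]eq_bigr do rewrite wE.
  under [X in _ - X]eq_bigr do rewrite wE.
  rewrite -mulr_suml sumr_const card_ord.
  have <- : cyc 1 tr = \sum_(i < f) cyc (b ^+ i) (coord x).
    by rewrite cyc_tr; apply: eq_bigr => i _; rewrite mul1r.
  by rewrite mulrnAr divff // scalerBl scale1r scaler_nat.
have x0 : cyc 1 (coord x) = 0.
  (* With [Tr X = 0], testing against [W = 1 / X] gives [- f]. *)
  apply/eqP/contraT => nz_x; have [w wP] := cyc_inv nz_x.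
  case/eqP: nzf; apply: oppr_inj; rewrite oppr0; apply: (test w); rewrite sumE.
  under [X in _ - X]eq_bigr do rewrite wP //.
  have -> : \sum_(i < f) cyc (b ^+ i) (coord x) = cyc 1 tr.
    by rewrite cyc_tr; apply: eq_bigr => i _; rewrite mul1r.
  by rewrite tr0 mul0r sub0r sumr_const card_ord scaleNr scaler_nat.
by apply: coord_inj => i; rewrite (cyc_eq0 x0) /coord (@zext0 n.+2).
Qed.

(** The norm is fixed by [sigma_b], so both sides differ by a constant independent of [t], which is
    0 because they agree at [t = 0]. *)
Lemma norm_conv_shift (x : 'Z_l -> K) t :
  norm_conv b (fun _ : 'I_f => x) (b * t) = norm_conv b (fun _ : 'I_f => x) t.
Proof.
pose N := norm_conv b (fun _ : 'I_f => x).
have Ub1 : b \is a GRing.unit := Ub 1.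
suff /cyc_inj/(_ t) : cyc 1 (fun t => N (b * t)) = cyc 1 N.
  by rewrite mulr0 subrr => /eqP; rewrite subr_eq0 => /eqP.
rewrite -[in LHS](invrK b) cyc_dilate ?unitrV // !cyc_norm_conv mul1r.
rewrite -(@big_cyclic_shift _ _ _ _ _ _ (fun c => cyc (b^-1 * c) x) b_root).
by apply: eq_bigr => j _; rewrite mulKr // mul1r.
Qed.

End Polarization.

(** * The maps [phi_d] and the forms [T_t] in terms of [cyc] and [norm_conv] *)

Lemma coordZ a (x : 'rV[K]_n.+1) i : coord (a *: x) i = a * coord x i.
Proof.
rewrite /coord; elim/Zp_ind: i; first by rewrite !zext0 mulr0.
by move=> k; rewrite !(@zextS n.+2) !mxE.
Qed.

(** The subtracted sum is the coefficient at 0, which [row_of] removes; the terms [i = 0] vanish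
    since [x_0 = 0]. *)
Lemma phi_mapE f (d : {unit 'Z_l}) (x y : 'rV[K]_n.+1) :
  @phi_map K l f d x y = (-1) ^+ (f - 1) *:
    row_of (conv (fun i => coord x ((- val d)^-1 * i)) (coord y)).
Proof.
apply/rowP => k; rewrite !mxE; congr (_ * (_ - _)).
  rewrite /conv [RHS](bigD1 0) //= mulr0 {1}/coord (@zext0 n.+2) mul0r add0r.
  by apply: eq_bigr => i _; rewrite invrN mulNr.
rewrite /conv [RHS](bigD1 0) //= mulr0 {1}/coord (@zext0 n.+2) mul0r add0r.
by apply: eq_bigr => i _; rewrite invrN mulNr sub0r.
Qed.

Lemma phi_map_linear f (d : {unit 'Z_l}) :
  (forall y, linear (@phi_map K l f d ^~ y)) /\ (forall x, linear (@phi_map K l f d x)).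
Proof.
have convl u u' v a t : conv (fun i => a * u i + u' i) v t =
    a * conv u v t + conv u' v t.
  rewrite /conv mulr_sumr -big_split; apply: eq_bigr => i _.
  by rewrite mulrDl mulrA.
have convr u v v' a t : conv u (fun i => a * v i + v' i) t =
    a * conv u v t + conv u v' t.
  rewrite /conv mulr_sumr -big_split; apply: eq_bigr => i _.
  by rewrite mulrDr mulrCA.
have eq_conv u u' v v' t : u =1 u' -> v =1 v' -> conv u v t = conv u' v' t.
  by move=> uu' vv'; apply: eq_bigr => i _; rewrite uu' vv'.
split=> [y a u v | x a u v]; rewrite !phi_mapE; apply/rowP => k; rewrite !mxE.
  rewrite !(eq_conv _ _ (coord y) _ _ (fun i => coordP a u v _) (frefl _)) !convl.
  by ring.
by rewrite !(eq_conv _ _ _ _ _ (frefl _) (coordP a u v)) !convr; ring.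
Qed.

Lemma cyc_phi_map f (d : {unit 'Z_l}) c x y : c \is a GRing.unit ->
  cyc c (coord (@phi_map K l f d x y)) =
  (-1) ^+ (f - 1) *: (cyc (c * - val d) (coord x) * cyc c (coord y)).
Proof.
move=> Uc; rewrite phi_mapE (eq_cyc _ (coordZ _ _)) cycZ cyc_row_of // cycM.
by rewrite cyc_dilate // unitrN; exact: (valP d).
Qed.

Lemma meval_zext (x : 'rV[K]_n.+1) i :
  (@zext l {mpoly K[n.+1]} (fun k => 'X_k) i).@[x 0] = coord x i.
Proof.
rewrite /coord; elim/Zp_ind: i; first by rewrite !zext0 meval0.
by move=> k; rewrite !(@zextS n.+2) mevalXU.
Qed.

Lemma meval_Tpoly f b t (x : 'rV[K]_n.+1) :
  (@Tpoly K l f b t).@[x 0] = norm_conv b (fun _ : 'I_f => coord x) t.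
Proof.
rewrite /Tpoly raddf_sum; apply: eq_bigr => i _ /=.
by rewrite rmorph_prod; apply: eq_bigr => j _; apply: meval_zext.
Qed.

Lemma Tpoly_homog f b t : @Tpoly K l f b t \is f.-homog.
Proof.
rewrite /Tpoly rpred_sum // => i _; apply: dhomog_prod1 => j.
elim/Zp_ind: (i j) => [|k]; first by rewrite (@zext0 n.+2) dhomog0.
by rewrite (@zextS n.+2) dhomogX /= mdeg1.
Qed.

(** * Points of [V] as elements with norm in [K] *)

Section Variety.

Variables (f e : nat) (gamma : {unit 'Z_l}).
Hypotheses (f_gt1 : (1 < f)%N) (l_prime : prime l) (ef : l = (e * f + 1)%N).
Hypothesis gamma_gen : generator [set: {unit 'Z_l}] gamma.

Let g : 'Z_l := val gamma.
Let b : 'Z_l := g ^+ e.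
Let H : {mpoly K[n.+1]} := @hform K l f e gamma.
Let V : 'rV[K]_n.+1 -> Prop := @variety K l f e gamma.
Let N (x : 'rV[K]_n.+1) := norm_conv b (fun _ : 'I_f => coord x).

Lemma card_unit_Zp : #|[set: {unit 'Z_l}]| = n.+1.
Proof. by rewrite (card_units_Zp (ltn0Sn _)) totient_prime. Qed.

Lemma beta_root : b ^+ f = 1.
Proof.
rewrite /b /g -exprM -FinRing.val_unitX.
have -> : (e * f)%N = #|[set: {unit 'Z_l}]|.
  by rewrite card_unit_Zp; move: ef; rewrite addn1 => -[].
by rewrite expg_cardG ?inE.
Qed.

Lemma gammaX_unit k : g ^+ k \is a GRing.unit.
Proof. by rewrite /g -FinRing.val_unitX; exact: valP. Qed.

Lemma gammaX_neq0 k : g ^+ k != 0.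
Proof. by apply: contraTneq (gammaX_unit k) => ->; rewrite unitr0. Qed.

Lemma gammaX_surj t : t != 0 -> exists k, t = g ^+ k.
Proof.
move=> nzt.
have Ut : t \is a GRing.unit.
  rewrite -[t]natr_Zp unitZpE // prime_coprime // gtnNdvd //.
  by rewrite lt0n.
pose u : {unit 'Z_l} := FinRing.Unit Ut.
have : u \in <[gamma]>%g by rewrite -(eqP gamma_gen) inE.
by case/cycleP => k uk; exists k; rewrite /g -FinRing.val_unitX -uk.
Qed.

Lemma meval_hform (x : 'rV[K]_n.+1) : H.@[x 0] = gap g (N x).
Proof. by rewrite /hform mevalB !meval_Tpoly. Qed.

Lemma meval_hm m (x : 'rV[K]_n.+1) :
  (@hm K l f e gamma m).@[x 0] = N x (g ^+ m) - N x (g ^+ m.+1).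
Proof. by rewrite /hm mevalB !meval_Tpoly. Qed.

(** The equations of [V] equate the coefficients at [g, ..., g ^+ e]; invariance under [b = g ^+ e]
    then reaches every power of [g]. *)
Lemma variety_constant (x : 'rV[K]_n.+1) t : V x -> t != 0 -> N x t = N x g.
Proof.
move=> Vx /gammaX_surj[k ->].
have e_gt0 : (0 < e)%N by case: (posnP e) => // e0; have := ef; rewrite e0.
have N1e m : (1 <= m <= e)%N -> N x (g ^+ m) = N x g.
  elim: m => [|[|m] IH] // /andP[_ ltme].
  rewrite -IH; last by rewrite /= ltnW.
  have /Vx : (1 <= m.+1 <= e - 1)%N by rewrite /= subn1 -ltnS prednK.
  by rewrite meval_hm => /eqP; rewrite subr_eq0 => /eqP.
have Nshift q s : N x (b ^+ q * s) = N x s.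
  elim: q => [|q IH]; first by rewrite mul1r.
  by rewrite exprS -mulrA /N norm_conv_shift // beta_root.
rewrite (divn_eq k e) exprD mulnC exprM Nshift.
have := ltn_pmod k e_gt0; case: (k %% e)%N => [_|r ltr]; last first.
  by rewrite N1e //= ltnW.
(* Remainder 0 is outside the range from 1 to [e]; a shift by [b] turns it into [e]. *)
by rewrite -(Nshift 1%N) mulr1 expr1 N1e // e_gt0 leqnn.
Qed.

(** On [V] the norm has the coefficients of [h(x)] placed at 0, up to a constant, so all its
    conjugates equal [h(x)]. *)
Lemma cyc_norm_variety (x : 'rV[K]_n.+1) c : V x -> c \is a GRing.unit ->
  cyc c (N x) = (gap g (N x))%:A.
Proof.
move=> Vx Uc.
have NE : N x =1 fun t => gap g (N x) * (t == 0)%:R - - N x g.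
  move=> t; rewrite opprK; have [->|nzt] := eqVneq t 0.
    by rewrite mulr1 subrK.
  by rewrite mulr0 add0r variety_constant.
by rewrite (eq_cyc c NE) cycB cyc_delta cyc_const // subr0.
Qed.

Lemma variety_of_norm (x : 'rV[K]_n.+1) a : cyc 1 (N x) = a%:A ->
  V x /\ H.@[x 0] = a.
Proof.
move=> Na; split; last first.
  by rewrite meval_hform; apply: gap_cyc Na; exact: (gammaX_neq0 1).
move=> m _; rewrite meval_hm; move: Na; rewrite -(cyc_delta 1) => /cyc_inj Na.
have := Na (g ^+ m); rewrite -(Na (g ^+ m.+1)) !(negPf (gammaX_neq0 _)).
by rewrite mulr0 !subr0 => ->; rewrite subrr.
Qed.

Lemma phi_map_multiplication d :
  multiplication_map V H (@phi_map K l f d).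
Proof.
have cycN x y : V x -> V y ->
    cyc 1 (N (@phi_map K l f d x y)) =
    (H.@[x 0] * H.@[y 0])%:A.
  move=> Vx Vy; rewrite !meval_hform -scalerA -[_ *: _%:A]mulr_algl.
  (* As [N X] lies in [K], [h(x)] may be read off after [sigma_(-d)], matching the first factor of
     [phi_d]. *)
  rewrite -(@cyc_norm_variety x (- val d)) ?unitrN ?(valP d) //.
  rewrite -(@cyc_norm_variety y 1) ?unitr1 // !cyc_norm_conv -big_split /=.
  under eq_bigr => j _.
    rewrite mul1r cyc_phi_map; last by rewrite /b -exprM gammaX_unit.
    over.
  rewrite scaler_prod prodr_const card_ord -exprM mulnC -signr_odd.
  (* The sign [(-1)^(f-1)] enters once per conjugate, hence to the power [f]. *)
  have -> : odd (f * (f - 1)) = false.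
    by case: f f_gt1 => // k _; rewrite subn1 oddM /= andNb.
  rewrite scale1r; apply: eq_bigr => j _; rewrite mul1r.
  by rewrite [b ^+ j * _]mulrC.
split; first exact: phi_map_linear.
  by move=> x y Vx Vy; case: (variety_of_norm (cycN x y Vx Vy)).
by move=> x y Vx Vy; case: (variety_of_norm (cycN x y Vx Vy)).
Qed.

Lemma hform_regular : f`!%:R != 0 :> K -> regular_form f H.
Proof.
move=> nz_fact; split; first by rewrite rpredB ?Tpoly_homog.
exists (@polar f b g); split; first split.
- exact: polar_multilinear.
- exact: polar_symmetric.
- by move=> x; rewrite meval_hform polar_diag.
- by apply: polar_nondegenerate => //; [exact: beta_root | exact: (gammaX_neq0 1)].
Qed.

End Variety.

End CyclotomicEvaluation.

(** * From the Galois group to the degree of [zeta] *)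

(** The order of the group is the dimension over its fixed field, at most the dimension over [K]. *)
Lemma card_Gal_le_degree (K : fieldType) (L : splittingFieldType K) (a : L) :
  (#|'Gal(<<1; a>> / 1)%g| <= adjoin_degree 1%AS a)%N.
Proof.
rewrite (dim_fixedField 'Gal(<<1; a>> / 1)%G).
by apply: leq_trans (leq_div _ _) _; rewrite dim_Fadjoin dimv1 muln1.
Qed.

Theorem theorem1p5 (f l e : nat) (hf : (2 <= f)%N) (hl : prime l)
    (hodd : odd l) (hlef : l = (e * f + 1)%N) (K : fieldType)
    (hcharf : forall p : nat, p \in [pchar K] -> ~~ (p %| f`!)%N)
    (hcharl : l \notin [pchar K])
    (L : splittingFieldType K) (zeta : L)
    (hzeta : l.-primitive_root zeta)
    (hgal : 'Gal(<<1; zeta>> / 1) \isog [set: {unit 'Z_l}])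
    (gamma : {unit 'Z_l}) (hgamma : generator [set: {unit 'Z_l}] gamma) :
  [/\ regular_form f (hform K f e gamma),
      multiplicative_on (variety (K := K) f e gamma) (hform K f e gamma)
    & forall d : {unit 'Z_l},
        multiplication_map (variety (K := K) f e gamma) (hform K f e gamma)
          (phi_map (K := K) f d)].
Proof.
have nz_fact : f`!%:R != 0 :> K.
  (* If [f!] vanished in [K], the characteristic would be a prime dividing it. *)
  apply/negP => f0; have [p charp] := natf0_pchar (fact_gt0 f) f0.
  by have := hcharf p charp; rewrite (dvdn_pcharf charp) f0.
clear hodd hcharl hcharf; case: l hl => [|[|n]] // l_prime in hlef hzeta hgal gamma hgamma *.
have deg : (n.+1 <= adjoin_degree 1%AS zeta)%N.
  by rewrite -(card_unit_Zp l_prime) -(card_isog hgal) card_Gal_le_degree.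
have mul d := phi_map_multiplication hzeta deg hf l_prime hlef hgamma d.
split; [exact: (hform_regular hzeta deg) | by exists (phi_map f 1%g) | exact: mul].
Qed.
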